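(* Let $d=1$, $\mathcal{A}=[\alpha_{\min},\alpha_{\max}]$, $\mathcal{W}=[w_{\min},w_{\max}]$, and suppose that for every problem instance $x\in\mathcal{X}$ the function $f_x(\alpha,w)=f(x,\alpha,w)$ is a single polynomial in $(\alpha,w)$ of degree at most $\Delta_p\ge 2$ on all of $\mathcal{A}\times\mathcal{W}$ (one piece, no boundaries). Then the class $\mathcal{U}=\{u_\alpha\mid\alpha\in\mathcal{A}\}$ with $u_\alpha(x)=\max_{w\in\mathcal{W}}f(x,\alpha,w)$ satisfies $\mathrm{Pdim}(\mathcal{U})=O(\log\Delta_p)$.
   Context: Pseudo-dimension: a set $\{x_1,\dots,x_m\}$ is pseudo-shattered by $\mathcal{U}$ if there exist $r_1,\dots,r_m\in\mathbb{R}$ with $|\{(\mathrm{sign}(u(x_1)-r_1),\dots,\mathrm{sign}(u(x_m)-r_m)):u\in\mathcal{U}\}|=2^m$; $\mathrm{Pdim}(\mathcal{U})$ is the largest size of a pseudo-shattered set. *)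

(* Defs.v *)
From HB Require Import structures.
From mathcomp Require Import all_boot all_order all_algebra.
From mathcomp Require Import all_classical all_reals all_analysis.
Set Implicit Arguments. Unset Strict Implicit. Unset Printing Implicit Defensive.
Import Order.TTheory GRing.Theory Num.Theory.
Local Open Scope classical_set_scope.
Local Open Scope ring_scope.

Definition poly2_eval (R : ringType) (D : nat) (c : 'I_D.+1 -> 'I_D.+1 -> R)
  (a w : R) : R :=
  \sum_(i < D.+1) \sum_(j < D.+1 | (i + j <= D)%N) c i j * a ^+ i * w ^+ j.

Definition pshattered (R : realType) (X A : Type) (u : A -> X -> R)
  (dom : set A) (m : nat) (xs : 'I_m -> X) : Prop :=
  injective xs /\
  exists r : 'I_m -> R, forall b : 'I_m -> bool,
    exists2 a, dom a & forall i, (r i <= u a (xs i)) = b i.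

(* u_a(x) = max_{w in [wmin,wmax]} f x a w  (the max is attained since f x a
   is a polynomial on a compact interval, so it equals the sup). *)
Definition umax (R : realType) (X : Type) (f : X -> R -> R -> R)
  (wmin wmax : R) (a : R) (x : X) : R :=
  sup [set f x a w | w in `[wmin, wmax]].

(* Main.v *)
Require Import Defs.
From HB Require Import structures.
From mathcomp Require Import all_boot all_order all_algebra.
From mathcomp Require Import all_classical all_reals all_analysis.
From mathcomp Require Import perm polyXY zify ring lra.
Set Implicit Arguments.
Unset Strict Implicit.
Unset Printing Implicit Defensive.
Import Order.TTheory GRing.Theory Num.Theory.
Import numFieldNormedType.Exports.
Local Open Scope classical_set_scope.
Local Open Scope ring_scope.

(** Shattering survives a small decrease of the thresholds, since only finitely
    many witnesses are involved, so each threshold may be taken outside a finite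
    set of exceptional levels.  If u is the maximum over w in [wmin, wmax] of
    p(a, w) and u(a) = r, then the maximum is attained either at wmin, or at
    wmax, or at an interior point where p - r and the w-derivative p' vanish
    together, so that a is a root of the resultant in w of p - r and p'.  For all
    but finitely many r this resultant is not the zero polynomial: the gcds of
    p' with p - r for distinct r are pairwise coprime and all divide p'.  Hence u
    meets a generic level at most 2 d + 2 d^2 times, and by continuity the 2^m
    witnesses lie in distinct gaps between m (2 d + 2 d^2) points. *)

(** * Finite root lists and the degree of a resultant *)

Lemma bounded_pred_seq (T : eqType) (B : T -> Prop) (n : nat) :
  (forall s : seq T, uniq s -> (forall x, x \in s -> B x) -> (size s <= n)%N) ->
  exists2 s : seq T, (size s <= n)%N & forall x, B x -> x \in s.
Proof.
move=> Bn.
(* Greedy extension of [s] by missed elements of [B], with fuel [k]: once [size s] reaches [n], one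
   more element contradicts [Bn]. *)
suff H k s : uniq s -> (forall x, x \in s -> B x) -> (n <= k + size s)%N ->
    exists2 t : seq T, (size t <= n)%N & forall x, B x -> x \in t.
  by apply: (H n [::]) => //; rewrite addn0.
elim: k s => [|k IH] s us sB ns.
all: have [[x [Bx xs]]|full] := pselect (exists x, B x /\ x \notin s); last first.
all: try by exists s; [exact: Bn | move=> x Bx; apply/negPn/negP => xs; apply: full; exists x].
all: have uxs : uniq (x :: s) by rewrite /= xs.
all: have xsB : forall y, y \in x :: s -> B y
  by move=> y; rewrite inE => /predU1P[->|/sB].
- by have := Bn _ uxs xsB; rewrite /= ltnNge ns.
- by apply: (IH (x :: s)) => //=; rewrite addnS -addSn.
Qed.

Lemma poly_roots_seq (R : idomainType) (p : {poly R}) : p != 0 ->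
  exists2 s : seq R, (size s < size p)%N & forall x, root p x -> x \in s.
Proof.
move=> p0; have sp : (0 < size p)%N by rewrite size_poly_gt0.
have [|s ss sP] := @bounded_pred_seq _ (root p) (size p).-1; last first.
  by exists s => //; rewrite -(prednK sp) ltnS.
move=> s us sr; rewrite -ltnS (prednK sp); apply: max_poly_roots => //.
exact/allP.
Qed.

Lemma size_prod_leq_const (R : idomainType) (I : finType) (F : I -> {poly R})
    (d : nat) : (forall i, size (F i) <= d.+1)%N ->
  (size (\prod_i F i)%R <= (#|I| * d).+1)%N.
Proof.
move=> Fd; have [/existsP[i /eqP Fi0]|] := boolP [exists i, F i == 0].
  by rewrite (bigD1 i) //= Fi0 mul0r size_poly0.
rewrite negb_exists => /forallP F0.
rewrite size_prod // leq_subLR -sum1_card addnS ltnS -[X in (_ <= X)%N]/(_ + _)%N.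
rewrite big_distrl /= -big_split /=; apply: leq_sum => i _.
by rewrite mul1n add1n Fd.
Qed.

Lemma size_det_leq (R : idomainType) (n d : nat) (M : 'M[{poly R}]_n) :
  (forall i j, size (M i j) <= d.+1)%N -> (size (\det M) <= (n * d).+1)%N.
Proof.
move=> Md; rewrite /determinant (leq_trans (size_sum _ _ _)) //.
apply/bigmax_leqP => s _; rewrite mulr_sign.
have : (size (\prod_i M i (s i))%R <= (n * d).+1)%N.
  have := @size_prod_leq_const _ _ (fun i => M i (s i)) d; rewrite card_ord.
  exact.
by case: ifP; rewrite ?size_polyN.
Qed.

(** The Sylvester matrix has order [(size q).-1 + (size p).-1], and its entries are zero or
    coefficients of [p] and [q]. *)
Lemma size_resultant_leq (R : idomainType) (d : nat) (p q : {poly {poly R}}) :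
  (forall i, size (p`_i)%R <= d.+1)%N -> (forall i, size (q`_i)%R <= d.+1)%N ->
  (size (resultant p q) <= (((size q).-1 + (size p).-1) * d).+1)%N.
Proof.
move=> pd qd; apply: size_det_leq => i j; rewrite Sylvester_mxE.
by case: (fintype.split i) => k; rewrite mulrb; case: ifP; rewrite ?size_poly0.
Qed.

(** * Elimination of [w] at generic levels *)

Lemma coprimep_level (R : idomainType) (P : {poly {poly R}}) (r s : R) :
  r != s -> coprimep (P - r%:P%:P) (P - s%:P%:P).
Proof.
move=> rs; apply/coprimepP => d dr ds.
have : d %| (s - r)%:P%:P.
  have -> : (s - r)%:P%:P = (P - r%:P%:P) - (P - s%:P%:P).
    by rewrite !polyCB; ring.
  exact: dvdp_sub.
have c0 : (s - r)%:P%:P != 0 :> {poly {poly R}}.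
  by rewrite !polyC_eq0 subr_eq0 eq_sym.
move=> dc; have d0 : d != 0 by apply: contraNneq c0 => d0; rewrite -dvd0p -d0.
rewrite -size_poly_eq1 eqn_leq size_poly_gt0 d0 andbT.
by rewrite (leq_trans (dvdp_leq c0 dc)) // size_polyC; case: (_ != _).
Qed.

Lemma degenerate_levels_finite (R : idomainType) (P : {poly {poly R}}) : P^`() != 0 ->
  exists bad : seq R, forall r, r \notin bad ->
    resultant (P - r%:P%:P) P^`() != 0.
Proof.
move=> P'0; pose g r := gcdp (P - r%:P%:P) P^`().
have [|bad _ badP] := @bounded_pred_seq _
    (fun r => resultant (P - r%:P%:P) P^`() = 0) (size P^`()); last first.
  by exists bad => r; apply: contra => /eqP/badP.
move=> s us sB.
have sg r : r \in s -> (1 < size (g r))%N.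
  by move=> /sB/eqP; rewrite resultant_eq0.
suff [dv sz] : \prod_(r <- s) g r %| P^`() /\
    (size s < size (\prod_(r <- s) g r)%R)%N.
  exact: leq_trans (ltnW sz) (dvdp_leq P'0 dv).
elim: s us sg {sB} => [|r s IH] /=; first by rewrite big_nil dvd1p size_poly1.
move=> /andP[rs us] sg; rewrite big_cons.
have [|dv sz] := IH us; first by move=> t ts; apply: sg; rewrite inE ts orbT.
have gr := sg r (mem_head _ _).
have cop : coprimep (g r) (\prod_(t <- s) g t).
  elim: {us sg IH dv sz} s rs => [|t s IH]; first by rewrite big_nil coprimep1.
  rewrite inE negb_or => /andP[rt rs]; rewrite big_cons coprimepMr IH // andbT.
  apply: coprimep_dvdr (dvdp_gcdl _ _) _; apply: coprimep_dvdl (dvdp_gcdl _ _) _.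
  exact: coprimep_level.
split; first by rewrite Gauss_dvdp // dv dvdp_gcdr.
have g0 : g r != 0 by rewrite -size_poly_gt0 (leq_trans _ gr).
have p0 : \prod_(t <- s) g t != 0 by rewrite -size_poly_gt0 (leq_trans _ sz).
rewrite size_mul //.
by move: (size (g r)) (size (\prod_(t <- s) g t)) gr sz => m n /=; lia.
Qed.

(* In [P.[w, a]] the outer variable of [P] is [w], so [P^`()] is the partial
   derivative in [w]. *)
Lemma critical_eliminant (R : numDomainType) (d : nat) (P : {poly {poly R}}) :
  (size P <= d.+1)%N -> (forall i, size (P`_i)%R <= d.+1)%N -> P^`() != 0 ->
  exists bad : seq R, forall r, r \notin bad ->
    exists E : {poly R}, [/\ E != 0, (size E <= (2 * d * d).+1)%N &
      forall a w, P.[w, a] = r -> P^`().[w, a] = 0 -> root E a].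
Proof.
move=> sP cP P'0; have [bad badP] := degenerate_levels_finite P'0.
have cP' i : (size ((P^`())`_i)%R <= d.+1)%N.
  rewrite coef_deriv -scaler_nat; apply: leq_trans (cP i.+1).
  exact: size_scale_leq.
have sP' : (size (P^`())%R < size P)%N.
  by apply: lt_size_deriv; apply: contraNneq P'0 => ->; rewrite deriv0.
have sP'0 : (0 < size (P^`())%R)%N by rewrite size_poly_gt0.
(* A derivative of degree 0 in [w] is its own eliminant. Otherwise both polynomials are nonconstant,
   as [resultant_in_ideal] requires. *)
have [sP'1|sP'1] := leqP (size P^`()) 1.
  exists [::] => r _; exists ((P^`())`_0)%R.
  have P'C : P^`() = ((P^`())`_0%R)%:P by apply: size1_polyC.
  split; first by apply: contraNneq P'0 => e; rewrite P'C e polyC0.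
    by apply: leq_trans (cP' 0%N) _; rewrite ltnS; nia.
  by move=> a w _; rewrite P'C coefC eqxx hornerC => /eqP.
exists bad => r rb; exists (resultant (P - r%:P%:P) P^`()).
have sPr : size (P - r%:P%:P) = size P.
  rewrite size_polyDl // size_polyN (leq_ltn_trans (size_polyC_leq1 _)) //.
  exact: leq_trans sP'1 (ltnW sP').
split; first exact: badP.
  have -> : (2 * d * d = (d + d) * d)%N by lia.
  apply: leq_trans (@size_resultant_leq _ d _ _ _ _) _ => //.
    move=> i; rewrite coefB coefC; case: eqP => _; last by rewrite subr0.
    rewrite (leq_trans (size_polyD _ _)) // geq_max cP size_polyN.
    by rewrite (leq_trans (size_polyC_leq1 _)).
  rewrite sPr ltnS leq_mul2r; apply/orP; right; move: sP sP'.
  by move: (size P) (size P^`()) => m n; lia.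
have [||[u v] [_ _ /= uv]] := resultant_in_ideal (p := P - r%:P%:P) (q := P^`()) => //.
  by rewrite sPr; exact: ltn_trans sP'1 sP'.
move=> a w Pr P'r; apply/rootP.
have /(congr1 (fun Q => Q.[w, a])) := uv.
by rewrite !hornerE Pr P'r => ->; ring.
Qed.

(** * Level sets of the maximum over [w] *)

Lemma deriv_eq0_const (R : numDomainType) (P : {poly {poly R}}) :
  P^`() = 0 -> P = (P`_0)%:P.
Proof.
move=> P'0; apply/polyP => -[|i]; rewrite coefC //=; apply/polyP => j.
have /(congr1 (fun p : {poly R} => p`_j)) : (P^`())`_i = 0 by rewrite P'0 coef0.
by rewrite coef_deriv coefMn coef0 => /eqP; rewrite mulrn_eq0 /= => /eqP.
Qed.

(** Polynomial counterpart of [umax], meaningful for every real [a], so that continuity and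
    crossings can be studied on the whole line. *)
Definition slice_max (R : realType) (P : {poly {poly R}}) (wmin wmax a : R) : R :=
  sup [set P.[w, a] | w in `[wmin, wmax]].

Lemma slice_max_attained (R : realType) (P : {poly {poly R}}) (wmin wmax a : R) :
  wmin <= wmax ->
  exists w, [/\ w \in `[wmin, wmax], slice_max P wmin wmax a = P.[w, a] &
    forall v, v \in `[wmin, wmax] -> P.[v, a] <= P.[w, a]].
Proof.
(* Swapping the variables lets [a] be substituted first, leaving a univariate polynomial in [w]. *)
move=> lewm; pose q := (swapXY P).[a%:P].
have qE w : q.[w] = P.[w, a] by rewrite horner2_swapXY.
have [w wI wmax_] := EVT_max lewm (continuous_subspaceT (@continuous_horner _ q)).
have ubw v : v \in `[wmin, wmax] -> P.[v, a] <= P.[w, a].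
  by rewrite -!qE; exact: wmax_.
exists w; split => //; apply/eqP; rewrite eq_le; apply/andP; split.
- apply: ge_sup; first by exists P.[w, a]; exists w.
  by move=> _ [v vI <-]; exact: ubw.
- apply: ub_le_sup; last by exists w.
  by exists P.[w, a] => _ [v vI <-]; exact: ubw.
Qed.

Lemma interior_max_critical (R : realType) (P : {poly {poly R}}) (wmin wmax a w : R) :
  w \in `]wmin, wmax[ ->
  (forall v, v \in `]wmin, wmax[ -> P.[v, a] <= P.[w, a]) ->
  P^`().[w, a] = 0.
Proof.
move=> wI wM; pose q := (swapXY P).[a%:P].
have qE v : q.[v] = P.[v, a] by rewrite horner2_swapXY.
have le_wm : wmin <= wmax by move: wI; rewrite in_itv /= => /andP[/lt_trans h /h /ltW].
have qM v : v \in `]wmin, wmax[ -> q.[v] <= q.[w] by rewrite !qE; exact: wM.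
have d0 := derive1_at_max le_wm (fun v _ => @derivable_horner _ q v) wI qM.
have := @derive_val _ _ _ _ _ _ _ d0.
rewrite (@derive_val _ _ _ _ _ _ _ (is_derive_poly q w)).
by rewrite -horner2_swapXY /q !horner_swapXY deriv_map.
Qed.

Lemma slice_max_level_set (R : realType) (d : nat) (P : {poly {poly R}})
    (wmin wmax : R) :
  (size P <= d.+1)%N -> (forall i, size (P`_i)%R <= d.+1)%N -> wmin <= wmax ->
  exists bad : seq R, forall r, r \notin bad ->
    exists2 s : seq R, (size s <= 2 * d + 2 * d * d)%N &
      forall a, slice_max P wmin wmax a = r -> a \in s.
Proof.
move=> sP cP lewm.
have szY : (sizeY P <= d.+1)%N by apply/bigmax_leqP.
(* The restriction to [w = v] can be identically [r] only if [r] is its constant coefficient, so one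
   excluded level suffices. *)
have edge v : forall r, r != (P.[v%:P])`_0 ->
    exists2 s : seq R, (size s <= d)%N & forall a, P.[v, a] = r -> a \in s.
  move=> r rv; have [|s ss sP'] := @poly_roots_seq _ (P.[v%:P] - r%:P).
    apply: contraNneq rv => /eqP; rewrite subr_eq0 => /eqP ->.
    by rewrite coefC.
  exists s => [|a Pa]; last by apply: sP'; rewrite /root !hornerE Pa subrr.
  rewrite -ltnS (leq_trans ss) // (leq_trans (size_polyD _ _)) // geq_max.
  rewrite (leq_trans (max_size_evalC _ _)) //= size_polyN.
  by rewrite (leq_trans (size_polyC_leq1 _)).
(* The condition [P.[w, a] != P.[wmin, a]] disposes of the case where [P] does not depend on [w]: no
   such [w] exists then. *)
have [bad critP] : exists bad : seq R, forall r, r \notin bad ->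
    exists2 s : seq R, (size s <= 2 * d * d)%N &
      forall a w, P.[w, a] = r -> P^`().[w, a] = 0 -> P.[w, a] != P.[wmin, a] ->
        a \in s.
  have [P'0|P'0] := eqVneq P^`() 0.
    exists [::] => r _; exists [::] => // a w _ _.
    by rewrite (deriv_eq0_const P'0) !hornerC eqxx.
  have [bad badP] := critical_eliminant sP cP P'0; exists bad => r /badP[E [E0 sE EP]].
  have [s ss sr] := poly_roots_seq E0; exists s; first by rewrite -ltnS (leq_trans ss).
  by move=> a w Pr P'r _; apply: sr; exact: EP Pr P'r.
exists [:: (P.[wmin%:P])`_0, (P.[wmax%:P])`_0 & bad] => r.
rewrite !inE !negb_or => /and3P[/edge[s1 ss1 s1P] /edge[s2 ss2 s2P] /critP[s3 ss3 s3P]].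
exists (s1 ++ s2 ++ s3) => [|a ar]; first by rewrite !size_cat; lia.
have [w [wI]] := slice_max_attained P a lewm; rewrite ar => Pw wM.
rewrite !mem_cat.
have [e1|ne1] := eqVneq P.[wmin, a] P.[w, a]; first by rewrite s1P // e1.
have [e2|ne2] := eqVneq P.[wmax, a] P.[w, a]; first by rewrite s2P ?orbT // e2.
rewrite (s3P a w) ?orbT // 1?eq_sym //.
apply: (@interior_max_critical _ _ wmin wmax); last first.
  by move=> v vI; apply: wM; apply: subset_itv_oo_cc vI.
move: wI; rewrite !in_itv /= !le_eqVlt => /andP[/predU1P[e|->] /predU1P[e'|->]] //.
- by rewrite e eqxx in ne1.
- by rewrite e eqxx in ne1.
- by rewrite e' eqxx in ne2.
Qed.

(** * Continuity of the maximum over [w] *)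

Lemma poly_bounded_lipschitz (R : numDomainType) (M : R) (p : {poly R}) :
  exists K B, forall a b, `|a| <= M -> `|b| <= M ->
    `|p.[a]| <= B /\ `|p.[a] - p.[b]| <= K * `|a - b|.
Proof.
elim/poly_ind: p => [|p c [K [B IH]]].
  by exists 0, 0 => a b _ _; rewrite !horner0 subrr normr0 mul0r.
(* The increment of [p * 'X] splits as [(p.[a] - p.[b]) * a + p.[b] * (a - b)]; the second term is
   why the bound [B] is carried along. *)
exists (K * M + B), (B * M + `|c|) => a b aM bM.
have [pa pab] := IH a b aM bM; have [pb _] := IH b a bM aM.
rewrite !hornerE; split.
  by rewrite (le_trans (ler_normD _ _)) // lerD2r normrM ler_pM.
have -> : p.[a] * a + c - (p.[b] * b + c) = (p.[a] - p.[b]) * a + p.[b] * (a - b).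
  by ring.
rewrite (le_trans (ler_normD _ _)) // !normrM mulrDl lerD //.
  by rewrite mulrAC ler_pM.
by rewrite ler_wpM2r.
Qed.

(** Uniformity of [K] in [w] is what lets the estimate pass to the maximum. *)
Lemma bipoly_lipschitz (R : numDomainType) (M : R) (P : {poly {poly R}}) :
  exists K, forall a b w, `|a| <= M -> `|b| <= M -> `|w| <= M ->
    `|P.[w, a] - P.[w, b]| <= K * `|a - b|.
Proof.
elim/poly_ind: P => [|P p [K IH]].
  by exists 0 => a b w _ _ _; rewrite !horner0 subrr normr0 mul0r.
have [L [B pL]] := poly_bounded_lipschitz M p.
exists (K * M + L) => a b w aM bM wM; rewrite !hornerE.
have -> : P.[w, a] * w + p.[a] - (P.[w, b] * w + p.[b])
    = (P.[w, a] - P.[w, b]) * w + (p.[a] - p.[b]) by ring.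
rewrite (le_trans (ler_normD _ _)) // normrM mulrDl lerD ?(pL a b aM bM).2 //.
by rewrite mulrAC ler_pM // IH.
Qed.

Lemma slice_max_continuous (R : realType) (P : {poly {poly R}}) (wmin wmax : R) :
  wmin <= wmax -> continuous (slice_max P wmin wmax).
Proof.
move=> lewm a.
(* [M] dominates all of [[wmin, wmax]] and every [b] within distance 1 of [a]. *)
pose M := `|a| + 1 + `|wmin| + `|wmax|.
have [K PK] := bipoly_lipschitz M P.
have wM w : w \in `[wmin, wmax] -> `|w| <= M.
  rewrite in_itv /= => /andP[w1 w2]; rewrite /M ler_norml.
  have := ler_norm wmax; have := ler_norm (- wmin); rewrite normrN; have := normr_ge0 a.
  have := normr_ge0 wmax; have := normr_ge0 wmin; lra.
have aM b : `|a - b| <= 1 -> `|b| <= M.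
  move=> ab; have := ler_normB a (a - b); rewrite opprB addrC subrK /M.
  have := normr_ge0 wmax; have := normr_ge0 wmin; lra.
have aM0 : `|a| <= M by apply: aM; rewrite subrr normr0 ler01.
(* A maximizer [w] at [b] is also a competitor at [c], so the difference of maxima is at most
   [P.[w, b] - P.[w, c]]. *)
have half b c : `|b| <= M -> `|c| <= M ->
    slice_max P wmin wmax b - slice_max P wmin wmax c <= K * `|b - c|.
  move=> bM cM; have [w [wI -> _]] := slice_max_attained P b lewm.
  have [v [_ -> vM]] := slice_max_attained P c lewm.
  apply: le_trans (PK b c w bM cM (wM _ wI)); apply: le_trans (ler_norm _).
  by rewrite lerB // vM.
have gK b : `|a - b| <= 1 ->
    `|slice_max P wmin wmax a - slice_max P wmin wmax b| <= (`|K| + 1) * `|a - b|.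
  (* The sign of [K] is unknown; [|K| + 1] is a positive replacement, by which one can divide
     below. *)
  move=> /aM bM; apply: (@le_trans _ _ (K * `|a - b|)); last first.
    by rewrite ler_wpM2r // (le_trans (ler_norm K)) // lerDl ler01.
  rewrite ler_norml half // andbT lerNl opprB distrC.
  exact: half.
apply/cvgrPdist_le => e e0.
have K0 : 0 < `|K| + 1 by rewrite ltr_wpDl.
near=> b; apply: le_trans (gK b _) _.
  by near: b; apply: cvgr_dist_le => //; exact: cvg_id.
rewrite -ler_pdivlMl // mulrC.
near: b; apply: cvgr_dist_le; first exact: cvg_id.
exact: divr_gt0.
Unshelve. all: by end_near. Qed.

(** * Counting sign patterns by crossings *)

Lemma count_ltn_strict (T : eqType) (p q : pred T) (s : seq T) (c : T) :
  (forall x, p x -> q x) -> c \in s -> q c -> ~~ p c -> (count p s < count q s)%N.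
Proof.
move=> pq cs qc pc; elim: s cs => //= x s IH; rewrite inE => /predU1P[<-|/IH cs].
  by rewrite qc (negbTE pc) add0n add1n ltnS sub_count.
by rewrite -addnS leq_add //; have := pq x; case: (p x) => // ->.
Qed.

(** A change of side forces a crossing strictly between [a] and [b], by the intermediate value
    theorem, and that point of [s] is counted for only one of them. *)
Lemma same_side_of_level (R : realType) (g : R -> R) (s : seq R) (r a b : R) :
  continuous g -> (forall c, g c = r -> c \in s) -> g a != r -> g b != r ->
  count (fun z => z < a) s = count (fun z => z < b) s ->
  (r <= g a) = (r <= g b).
Proof.
move=> gc gs; wlog ab : a b / a <= b => [H ar br|].
  case: (leP a b) => [|/ltW] ab; first exact: H.
  by move=> /esym /(H _ _ ab br ar) ->.
move=> ar br cnt; apply/eqP; apply: contraPT (cnt) => side.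
have [||c cI gcr] := @IVT _ g a b r ab; first exact: continuous_subspaceT.
  rewrite ge_min le_max; move: side.
  by case: (leP r (g a)) => [_|/ltW ->]; case: (leP r (g b)) => [_|/ltW ->] //=;
    rewrite ?eqxx ?orbT.
have ca : a < c.
  rewrite lt_neqAle (itvP cI) andbT; apply: contraNneq ar => ->; exact/eqP.
have cb : c < b.
  rewrite lt_neqAle (itvP cI) andbT; apply: contraNneq br => <-; exact/eqP.
apply/eqP; rewrite neq_ltn (@count_ltn_strict _ _ _ _ c) //.
- by move=> z /lt_le_trans; apply.
- exact: gs.
- by rewrite -leNgt ltW.
Qed.

(** Lowering a threshold from [r] to [r'] changes no comparison with a value in [V], and [r'] itself
    avoids [V]. *)
Lemma lower_level (R : realFieldType) (V : seq R) (r : R) :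
  exists2 r', r' < r & forall v, v \in V -> v < r -> v < r'.
Proof.
elim: V => [|v V [r' r'r IH]]; first by exists (r - 1) => //; rewrite gtrBl ltr01.
have [rv|vr] := leP r v.
  by exists r' => // x; rewrite inE => /predU1P[->|/IH //]; rewrite ltNge rv.
exists ((Num.max r' v + r) / 2) => [|x].
  by rewrite midf_lt // gt_max r'r.
have h : Num.max r' v < (Num.max r' v + r) / 2 by rewrite midf_lt // gt_max r'r.
rewrite inE => /predU1P[->|/IH xr /xr xr'].
  by move=> _; apply: le_lt_trans h; rewrite le_max lexx orbT.
by apply: lt_trans h; rewrite lt_max xr'.
Qed.

(** The number of crossing points below [a b], taken over all [i] together, determines [b] and is at
    most [m * N]. *)
Lemma pow2_le_of_crossings (R : realType) (m N : nat) (g : 'I_m -> R -> R)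
    (r : 'I_m -> R) (a : {ffun 'I_m -> bool} -> R) :
  (forall i, continuous (g i)) ->
  (forall i, exists bad : seq R, forall t, t \notin bad ->
     exists2 s : seq R, (size s <= N)%N & forall c, g i c = t -> c \in s) ->
  (forall b i, (r i <= g i (a b)) = b i) ->
  (2 ^ m <= (m * N).+1)%N.
Proof.
move=> gc gbad sh.
have level i : exists ts : R * seq R, [/\ (size ts.2 <= N)%N,
    (forall c, g i c = ts.1 -> c \in ts.2), (forall b, g i (a b) != ts.1) &
    forall b, (ts.1 <= g i (a b)) = b i].
  have [bad badP] := gbad i.
  pose V := bad ++ [seq g i (a b) | b <- enum {ffun 'I_m -> bool}].
  (* Including [bad] in [V] also forces the new level to avoid [bad]. *)
  have [t tr tP] := lower_level V (r i).
  have tn v : v \in V -> v != t.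
    move=> /tP vt; have [rv|/vt] := leP (r i) v; last by move=> /lt_eqF ->.
    by rewrite gt_eqF // (lt_le_trans tr).
  have mem b : g i (a b) \in V.
    by rewrite mem_cat (map_f (fun b => g i (a b))) ?mem_enum ?orbT.
  have [|s ss sP] := badP t.
    apply/negP => tb; suff /eqP : t != t by [].
    by apply: tn; rewrite mem_cat tb.
  exists (t, s); split => //= b; first exact: tn.
  rewrite -sh; have [rg|gr] := leP (r i) (g i (a b)).
    by rewrite (le_trans (ltW tr)).
  by apply/negbTE; rewrite -ltNge tP.
have [ts tsP] := choice level.
pose S := flatten [seq (ts i).2 | i <- enum 'I_m].
have sS : (size S <= m * N)%N.
  rewrite size_flatten /shape -map_comp sumnE big_map big_enum /=.
  apply: (@leq_trans (\sum_(i < m) N)%N); last by rewrite sum_nat_const card_ord.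
  by apply: leq_sum => i _; case: (tsP i).
pose k b : 'I_(m * N).+1 := inord (count (fun z => z < a b) S).
have kE b : k b = count (fun z => z < a b) S :> nat.
  by rewrite inordK // ltnS (leq_trans (count_size _ _)).
have kinj : injective k.
  move=> b b' /(congr1 val) /=; rewrite !kE => kk; apply/ffunP => i.
  have [_ cr ne side] := tsP i; rewrite -(side b) -(side b').
  apply: (@same_side_of_level _ (g i) S) => // c /cr cs.
  by apply/flattenP; exists (ts i).2 => //; apply: map_f; rewrite mem_enum.
by have := leq_card k kinj; rewrite card_ffun card_bool !card_ord.
Qed.

(** * Arithmetic of the final bound *)

Lemma sqr_le_pow2 (m : nat) : (m.+1 ^ 2 <= 4 * 2 ^ m)%N.
Proof.
(* The induction starts at 2, from where the left side at most doubles at each step. *)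
by case: m => [|[|m]] //; elim: m => // m; rewrite (expnS 2 m.+2) -!mulnn; move: (2 ^ _)%N => x; nia.
Qed.

(** Squaring [2 ^ m <= m.+1 * Q] and bounding [m.+1 ^ 2] by [4 * 2 ^ m] removes the factor [m],
    leaving [4 * Q ^ 2]; then 3 and 4 are absorbed into [d ^ 2]. *)
Lemma shatter_size_nat (m d : nat) : (2 <= d)%N ->
  (2 ^ m <= (m * (2 * d + 2 * d * d)).+1)%N -> (2 ^ m <= d ^ 10)%N.
Proof.
move=> d2 h; pose Q := (3 * d ^ 2)%N.
have h1 : (2 ^ m <= m.+1 * Q)%N by apply: leq_trans h _; rewrite /Q; nia.
have h2 : (2 ^ m * 2 ^ m <= 4 * Q ^ 2 * 2 ^ m)%N.
  apply: leq_trans (leq_mul h1 h1) _; rewrite mulnACA !mulnn.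
  by rewrite mulnAC leq_mul2r sqr_le_pow2 orbT.
have h3 : (2 ^ m <= 4 * Q ^ 2)%N by move: h2; rewrite leq_pmul2r // expn_gt0.
apply: leq_trans h3 _.
have -> : (d ^ 10 = d ^ 2 * (d ^ 2 * d ^ 2) ^ 2)%N by rewrite -!expnD -expnM -expnD.
apply: leq_mul; first by rewrite (leq_exp2r 2 d (e := 2)).
by rewrite leq_exp2r // leq_mul2r (leq_trans (_ : 3 <= 2 ^ 2)%N) ?orbT // leq_exp2r.
Qed.

(** * Reduction of the class to slice maxima *)

Lemma poly2_eval_bipoly (R : realType) (D : nat) (c : 'I_D.+1 -> 'I_D.+1 -> R) :
  exists P : {poly {poly R}}, [/\ (size P <= D.+1)%N,
    (forall i, size (P`_i)%R <= D.+1)%N & forall a w, poly2_eval c a w = P.[w, a]].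
Proof.
(* The total degree constraint becomes zero coefficients, leaving degree at most [D] in each
   variable. *)
pose E i j := if (i + j <= D)%N then c (inord i) (inord j) else 0.
exists (\poly_(j < D.+1) \poly_(i < D.+1) E i j); split.
- exact: size_poly.
- by move=> j; rewrite coef_poly; case: ifP; rewrite ?size_poly0 // size_poly.
move=> a w; rewrite horner_poly horner_sum /poly2_eval.
under eq_bigr do rewrite big_mkcond.
rewrite exchange_big /=; apply: eq_bigr => j _.
rewrite -polyC_exp hornerM hornerC horner_poly big_distrl /=; apply: eq_bigr => i _.
by rewrite /E !inord_val; case: ifP => _; rewrite ?mul0r.
Qed.

Theorem mainTheorem6 (R : realType) :
  exists C : R, forall (X : Type) (Dp : nat), (2 <= Dp)%N ->
  forall (amin amax wmin wmax : R), amin <= amax -> wmin <= wmax ->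
  forall f : X -> R -> R -> R,
  (forall x : X, exists c : 'I_Dp.+1 -> 'I_Dp.+1 -> R,
     forall a w : R, a \in `[amin, amax] -> w \in `[wmin, wmax] ->
       f x a w = poly2_eval c a w) ->
  forall (m : nat) (xs : 'I_m -> X),
    pshattered (umax f wmin wmax) `[amin, amax] xs ->
    m%:R <= C * ln (Dp%:R : R).
Proof.
(* Taking logarithms in [2 ^ m <= D ^ 10] gives this constant. *)
exists (10 / ln 2) => X D D2 amin amax wmin wmax _ lewm f fpoly m xs [_ [r sh]].
have reduce i : exists P : {poly {poly R}}, [/\ (size P <= D.+1)%N,
    (forall j, size (P`_j)%R <= D.+1)%N &
    forall a, a \in `[amin, amax] ->
      umax f wmin wmax a (xs i) = slice_max P wmin wmax a].
  have [c fc] := fpoly (xs i); have [P [sP cP PE]] := poly2_eval_bipoly c.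
  exists P; split => // a aI; rewrite /umax /slice_max; congr sup.
  by apply/seteqP; split => _ [w wI <-]; exists w => //; rewrite fc // PE.
have [P PP] := choice reduce.
(* Patterns become finite functions so that they form a finite type of cardinality [2 ^ m]. *)
have witness (b : {ffun 'I_m -> bool}) : exists a, a \in `[amin, amax] /\
    forall i, (r i <= umax f wmin wmax a (xs i)) = b i.
  by have [a aI ab] := sh b; exists a.
have [a aP] := choice witness.
have /(shatter_size_nat D2) : (2 ^ m <= (m * (2 * D + 2 * D * D)).+1)%N.
  apply: (@pow2_le_of_crossings _ _ _ (fun i => slice_max (P i) wmin wmax) r a).
  - by move=> i; exact: slice_max_continuous.
  - by move=> i; have [sP cP _] := PP i; exact: slice_max_level_set.
  - by move=> b i; have [aI <-] := aP b; have [_ _ <-] := PP i.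
rewrite -(ler_nat R) !natrX => le2.
have ln2 : 0 < ln (2 : R) by rewrite ln_gt0 // ltr1n.
have D0 : 0 < (D%:R : R) by rewrite ltr0n (leq_trans _ D2).
rewrite mulrAC ler_pdivlMr // [m%:R * _]mulr_natl [10 * _]mulr_natl -!lnXn //.
by rewrite ler_ln // posrE exprn_gt0.
Qed.
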